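(* Let $d\in\mathbb{N}$ and let $\varphi\in\mathcal{A}_d$ be arbitrary. Let $\alpha$ be such that $\varphi(1)\leq\alpha\leq d$. Then there exists a homogeneous Moran set $C\subseteq\mathbb{R}^d$ such that $\dim_{\mathrm{A}}C=\alpha$ and, for all $\theta\in(0,1)$, $$\dim_{\mathrm{A}}^{\theta}C=\varphi(\theta).$$
   Context: For $d\in\mathbb{N}$, $\mathcal{A}_d$ denotes the set of functions $\varphi\colon(0,1)\to[0,d]$ such that for all $0<\lambda<\theta<1$, $$0\leq (1-\lambda)\varphi(\lambda)-(1-\theta)\varphi(\theta)\leq(\theta-\lambda)\,\varphi\Bigl(\frac{\lambda}{\theta}\Bigr).$$ For $\varphi\in\mathcal{A}_d$ the limit $\varphi(1):=\lim_{\theta\to1}\varphi(\theta)$ exists. Homogeneous Moran sets: let $\mathcal{I}=\{0,1\}^d$ and let $\boldsymbol{r}=(r_n)_{n=1}^\infty\subset(0,1/2]$. For each $n\in\mathbb{N}$ and $\boldsymbol{i}\in\mathcal{I}$ define $S^n_{\boldsymbol{i}}\colon\mathbb{R}^d\to\mathbb{R}^d$ by $S^n_{\boldsymbol{i}}(x)=r_nx+b^n_{\boldsymbol{i}}$, where the $j$-th coordinate of $b^n_{\boldsymbol{i}}$ is $0$ if $\boldsymbol{i}^{(j)}=0$ and $1-r_n$ if $\boldsymbol{i}^{(j)}=1$. For $\sigma=(\boldsymbol{i}_1,\ldots,\boldsymbol{i}_n)\in\mathcal{I}^n$ write $S_\sigma=S^1_{\boldsymbol{i}_1}\circ\cdots\circ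 S^n_{\boldsymbol{i}_n}$. The homogeneous Moran set associated with $\boldsymbol{r}$ is $$C(\boldsymbol{r})=\bigcap_{n=1}^\infty\bigcup_{\sigma\in\mathcal{I}^n}S_\sigma([0,1]^d).$$ $\mathbb{R}^d$ carries the Euclidean norm and $B(x,\delta)$ is the open ball of centre $x$ and radius $\delta$. For bounded $E\subset\mathbb{R}^d$ and $\delta>0$, $N_\delta(E)$ is the least number of balls of radius $\delta$ required to cover $E$. For $\theta\in(0,1)$ the Assouad spectrum of $F\subset\mathbb{R}^d$ is $$\dim_{\mathrm{A}}^{\theta}F=\inf\Bigl\{\alpha:(\exists C>0)(\forall\, 0<\delta\leq 1)(\forall x\in F)\ N_{\delta^{1/\theta}}(F\cap B(x,\delta))\leq C\Bigl(\frac{\delta}{\delta^{1/\theta}}\Bigr)^{\alpha}\Bigr\}.$$ $\dim_{\mathrm{A}}F$ is the usual Assouad dimension: the infimum of $\alpha\geq 0$ for which there is $C>0$ such that $N_r(F\cap B(x,R))\leq C(R/r)^\alpha$ for all $0<r\leq R$ and $x\in F$. *)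

(* Defs.v *)
From mathcomp Require Import all_boot all_order all_algebra.
From mathcomp Require Import all_classical all_reals all_analysis.
Set Implicit Arguments.
Unset Strict Implicit.
Unset Printing Implicit Defensive.
Import Order.TTheory GRing.Theory Num.Theory.
Import numFieldNormedType.Exports.
Local Open Scope classical_set_scope.
Local Open Scope ring_scope.

(* The ambient functions are total on R; only their values on the open unit
   interval are constrained. *)
Definition classA (R : realType) (d : nat) (phi : R -> R) : Prop :=
  (forall theta : R, 0 < theta < 1 -> 0 <= phi theta <= d%:R) /\
  (forall lambda theta : R, 0 < lambda -> lambda < theta -> theta < 1 ->
     0 <= (1 - lambda) * phi lambda - (1 - theta) * phi theta
       <= (theta - lambda) * phi (lambda / theta)).

Definition value_at1 (R : realType) (phi : R -> R) : R :=
  lim (phi theta @[theta --> 1^'-]).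

(* The library norm on 'rV[R]_d is the sup norm, hence these definitions. *)
Definition euclidean_norm (R : realType) (d : nat) (x : 'rV[R]_d) : R :=
  Num.sqrt (\sum_(j < d) x ord0 j ^+ 2).

Definition euclidean_ball (R : realType) (d : nat) (x : 'rV[R]_d) (delta : R) :
    set 'rV[R]_d :=
  [set y | euclidean_norm (y - x) < delta].

Definition covered_by_balls (R : realType) (d : nat) (delta : R)
    (E : set 'rV[R]_d) (n : nat) : Prop :=
  exists c : 'I_n -> 'rV[R]_d, E `<=`
    \bigcup_(i : 'I_n) euclidean_ball (c i) delta.

(* An infimum of natural numbers: it is attained when finite, and is +oo
   exactly when no finite cover exists. *)
Definition covering_number (R : realType) (d : nat) (delta : R)
    (E : set 'rV[R]_d) : \bar R :=
  ereal_inf [set (n%:R : R)%:E | n in [set n : nat | covered_by_balls delta E n]].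

Definition assouad_spectrum (R : realType) (d : nat) (theta : R)
    (F : set 'rV[R]_d) : \bar R :=
  ereal_inf [set alpha%:E | alpha in [set alpha : R |
    exists2 C : R, 0 < C &
      forall (delta : R) (x : 'rV[R]_d), 0 < delta <= 1 -> F x ->
        (covering_number (delta `^ theta^-1) (F `&` euclidean_ball x delta)
         <= (C * (delta / delta `^ theta^-1) `^ alpha)%:E)%E]].

Definition assouad_dimension (R : realType) (d : nat) (F : set 'rV[R]_d) :
    \bar R :=
  ereal_inf [set alpha%:E | alpha in [set alpha : R | 0 <= alpha /\
    exists2 C : R, 0 < C &
      forall (r rho : R) (x : 'rV[R]_d), 0 < r -> r <= rho -> F x ->
        (covering_number r (F `&` euclidean_ball x rho)
         <= (C * (rho / r) `^ alpha)%:E)%E]].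

Definition unit_cube (R : realType) (d : nat) : set 'rV[R]_d :=
  [set x | forall j : 'I_d, 0 <= x ord0 j <= 1].

Definition moran_map (R : realType) (d : nat) (rn : R) (i : d.-tuple bool)
    (x : 'rV[R]_d) : 'rV[R]_d :=
  rn *: x + \row_(j < d) (if tnth i j then 1 - rn else 0).

(* Sequences and words are indexed from 0: r k is the contraction ratio
   r_(k+1), and letter k of sigma is i_(k+1).  The big operator folds to the
   right, so the first letter is the outermost map. *)
Definition moran_word_map (R : realType) (d : nat) (r : nat -> R) (n : nat)
    (sigma : n.-tuple (d.-tuple bool)) : 'rV[R]_d -> 'rV[R]_d :=
  \big[(fun f g : 'rV[R]_d -> 'rV[R]_d => f \o g)/id]_(k < n)
    moran_map (r k) (tnth sigma k).

Definition moran_set (R : realType) (d : nat) (r : nat -> R) : set 'rV[R]_d :=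
  \bigcap_(n in [set n : nat | (0 < n)%N])
    \bigcup_(sigma : n.-tuple (d.-tuple bool))
      moran_word_map r sigma @` @unit_cube R d.

Definition homogeneous_moran_set (R : realType) (d : nat)
    (C : set 'rV[R]_d) : Prop :=
  exists2 r : nat -> R, (forall n : nat, 0 < r n <= 2^-1) & C = @moran_set R d r.

(* Main.v *)
Require Import Defs.
From mathcomp Require Import all_boot all_order all_algebra.
From mathcomp Require Import all_classical all_reals all_analysis.
From mathcomp Require Import ring lra zify.
Set Implicit Arguments.
Unset Strict Implicit.
Unset Printing Implicit Defensive.
Import Order.TTheory GRing.Theory Num.Theory.
Import numFieldNormedType.Exports.
Local Open Scope classical_set_scope.
Local Open Scope ring_scope.

(* A homogeneous Moran set is governed by the times [tau n], where
   [expR (- tau n)] is the side of its level-[n] cubes: up to a constant factor,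
   a ball of radius [expR (- t)] needs [expR (f T - f t)] balls of radius
   [expR (- T)], where [f] is any nondecreasing function with
   [f (tau n) = n * d * ln 2].  Conversely every nondecreasing [d]-Lipschitz
   unbounded [f] arises from admissible ratios.  It remains to choose [f].

   Put [beta x = (1 - x) * phi x].  On windows [[S k, T k]] with [T k / S k]
   unbounded let [f u = const - T k * beta (u / T k)].  The class inequality
   reads [0 <= beta l - beta x <= x * beta (l / x)]; it makes [f] nondecreasing
   and gives [f v - f u <= v * beta (u / v)] inside a window, with equality for
   [v = T k].  Since the windows are extremely sparse and [f] is constant off
   them, this yields all the values [phi theta] at once.  After each window a
   short burst of slope [max alpha (1 / k)] and length [k] is added, invisible
   to the spectra, which raises the Assouad dimension to [alpha] (and makes [f]
   unbounded even when [alpha = 0]).  The windows do not exceed dimension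
   [alpha] because [phi x <= phi 1]. *)

(** * Addresses of the points of a homogeneous Moran set, one coordinate at a time *)

Section MoranDigits.
Variables (R : realType) (d : nat) (r : nat -> R).
Hypothesis hr : forall n : nat, 0 < r n <= 2^-1.

Definition side (n : nat) : R := \prod_(k < n) r k.

(** Left endpoint of the level-[n] interval with address [b] in one coordinate: a digit [true]
    selects the right child, which starts [side k - side k.+1] further on. *)
Definition digit_sum (b : nat -> bool) (n : nat) : R :=
  \sum_(k < n) (b k)%:R * (side k - side k.+1).

Lemma side0 : side 0 = 1.
Proof. by rewrite /side big_ord0. Qed.

Lemma sideS n : side n.+1 = side n * r n.
Proof. by rewrite /side big_ord_recr. Qed.

Lemma side_gt0 n : 0 < side n.
Proof. by apply: prodr_gt0 => k _; case/andP: (hr k). Qed.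

Lemma side_half n : 2 * side n.+1 <= side n.
Proof.
have := side_gt0 n; have /andP[r0 r1] := hr n; rewrite sideS => s0; nra.
Qed.

Lemma side_addl m n : 2 ^+ m * side (m + n) <= side n.
Proof.
elim: m => [|m IH]; first by rewrite expr0 mul1r add0n.
apply: le_trans IH; rewrite addSn exprSr -mulrA.
by rewrite ler_pM2l ?exprn_gt0 // side_half.
Qed.

Lemma digit_sum0 b : digit_sum b 0 = 0.
Proof. by rewrite /digit_sum big_ord0. Qed.

Lemma digit_sumS b n :
  digit_sum b n.+1 = digit_sum b n + (b n)%:R * (side n - side n.+1).
Proof. by rewrite /digit_sum big_ord_recr. Qed.

Lemma eq_digit_sum b c n : (forall k, (k < n)%N -> b k = c k) ->
  digit_sum b n = digit_sum c n.
Proof. by move=> bc; apply: eq_bigr => k _; rewrite bc. Qed.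

Lemma digit_sum_nest b m n : (m <= n)%N ->
  digit_sum b m <= digit_sum b n <= digit_sum b m + side m - side n.
Proof.
move=> mn; rewrite -(subnK mn); elim: (n - m)%N => [|k /andP[IH1 IH2]].
  by rewrite add0n; lra.
rewrite addSn digit_sumS; have h := side_half (k + m).
have s0 := side_gt0 (k + m).+1.
by case: (b (k + m)%N) => /=; apply/andP; split; lra.
Qed.

(** If the addresses already differ before the last digit, their distance is at least [side n], and
    one more digit changes it by at most [side n - side n.+1]. If only the last digit differs, the
    distance is [side n - side n.+1], which is at least [side n.+1] because the ratios are at most
    1/2. *)
Lemma digit_sum_sep b c n : (exists2 k, (k < n)%N & b k != c k) ->
  side n <= `|digit_sum b n - digit_sum c n|.
Proof.
elim: n => [[k]//|n IH [k]].
rewrite ltnS leq_eqVlt !digit_sumS => kn bc.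
have h := side_half n; have s0 := side_gt0 n.+1.
have [/hasP[i]|/hasPn eqbc] := boolP (has (fun i => b i != c i) (iota 0 n)).
  rewrite mem_iota /= add0n => lin bci.
  have := IH (ex_intro2 _ _ i lin bci); move: (digit_sum b n) (digit_sum c n).
  move=> x y hxy; rewrite ler_normr; move: hxy; rewrite ler_normr.
  by case: (b n); case: (c n) => /=; lra.
have -> : digit_sum b n = digit_sum c n.
  apply: eq_digit_sum => i lin; apply/eqP.
  by have := eqbc i; rewrite mem_iota /= add0n negbK; apply.
have kE : k = n.
  apply/eqP; move: kn; case: eqP => // _ /= lkn.
  by have := eqbc k; rewrite mem_iota /= add0n lkn bc => /(_ isT).
move: bc; rewrite kE ler_normr.
by case: (b n); case: (c n) => //= _; apply/orP; [left|right]; lra.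
Qed.

Lemma digit_sum_inj b c n :
  `|digit_sum b n - digit_sum c n| < side n -> digit_sum b n = digit_sum c n.
Proof.
move=> h; apply: eq_digit_sum => k kn; apply: contraTeq h => bc.
by rewrite -leNgt digit_sum_sep //; exists k.
Qed.

Lemma moran_word_mapE n (sigma : n.-tuple (d.-tuple bool)) (u : 'rV[R]_d) j :
  moran_word_map r sigma u ord0 j =
  side n * u ord0 j +
  \sum_(k < n) (tnth (tnth sigma k) j)%:R * (side k - side k.+1).
Proof.
(* The word has a fixed length, so the induction runs over its prefixes. *)
suff gen : forall m (le_mn : (m <= n)%N),
  (\big[(fun f g : 'rV[R]_d -> 'rV[R]_d => f \o g)/id]_(k < m)
    moran_map (r k) (tnth sigma (widen_ord le_mn k))) u ord0 j =
  side m * u ord0 j +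
  \sum_(k < m) (tnth (tnth sigma (widen_ord le_mn k)) j)%:R *
     (side k - side k.+1).
  have := gen n (leqnn n); rewrite /moran_word_map.
  have wid : forall k : 'I_n, widen_ord (leqnn n) k = k.
    by move=> k; apply: val_inj.
  under eq_bigr do rewrite wid.
  under [in X in _ = X -> _]eq_bigr do rewrite wid.
  done.
move=> m; elim: m u => [|m IH] u le_mn.
  by rewrite !big_ord0 side0 mul1r addr0.
pose op := (fun f g : 'rV[R]_d -> 'rV[R]_d => f \o g).
(* Peels off the last, innermost map; the induction hypothesis is then applied to the image of [u]
   under it. *)
have recr : forall p (F : 'I_p.+1 -> 'rV[R]_d -> 'rV[R]_d) v,
  (\big[op/id]_(k < p.+1) F k) v =
  (\big[op/id]_(k < p) F (widen_ord (leqnSn p) k)) (F ord_max v).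
  elim=> [|p IHp] F v.
    rewrite big_ord_recl !big_ord0 /op /=; congr (F _ _).
    exact: val_inj.
  rewrite big_ord_recl [in RHS]big_ord_recl /op /= IHp; congr (F _ _).
    exact: val_inj.
  rewrite (_ : lift ord0 ord_max = ord_max); last exact: val_inj.
  have wid (k : 'I_p) : F (lift ord0 (widen_ord (leqnSn p) k)) =
      F (widen_ord (leqnSn p.+1) (lift ord0 k)).
    by congr (F _); apply: val_inj.
  by rewrite (eq_bigr _ (fun k _ => wid k)).
rewrite recr big_ord_recr /= /moran_map.
have le_mn' : (m <= n)%N := ltnW le_mn.
have wid : forall k : 'I_m,
  widen_ord le_mn (widen_ord (leqnSn m) k) = widen_ord le_mn' k.
  by move=> k; apply: val_inj.
under eq_bigr do rewrite wid.
rewrite IH !mxE sideS.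
under [in RHS]eq_bigr do rewrite wid.
by case: (tnth (tnth sigma (widen_ord le_mn ord_max)) j) => /=; ring.
Qed.

(** The address may depend on the level [n], so no infinite address of [x] has to be constructed. *)
Lemma moran_setP (x : 'rV[R]_d) :
  moran_set r x <-> forall n, exists b : 'I_d -> nat -> bool, forall j,
    digit_sum (b j) n <= x ord0 j <= digit_sum (b j) n + side n.
Proof.
split=> [Cx n|Cx n /= n0].
  (* The intersection ranges over positive levels only; passing through level [n.+1] also covers
     [n = 0]. *)
  have [sigma _ [u uc xE]] := Cx n.+1 (ltn0Sn n).
  pose b j k := tnth (tnth sigma (inord k)) j.
  exists b => j.
  have eqS : x ord0 j = side n.+1 * u ord0 j + digit_sum (b j) n.+1.
    rewrite -xE moran_word_mapE; congr (_ + _); apply: eq_bigr => k _.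
    by rewrite /b inord_val.
  have /andP[u0 u1] := uc j; have s0 := side_gt0 n.+1.
  have /andP[n1 n2] := digit_sum_nest (b j) (leqnSn n).
  by rewrite eqS; apply/andP; split; nra.
have [b hb] := Cx n.
pose sigma := [tuple [tuple b j k | j < d] | k < n].
exists sigma => //.
have s0 := side_gt0 n.
exists (\row_j ((x ord0 j - digit_sum (b j) n) / side n)).
  move=> j; rewrite mxE; have /andP[h1 h2] := hb j.
  by rewrite divr_ge0 ?(ltW s0) ?subr_ge0 //= ler_pdivrMr // mul1r; lra.
apply/rowP => j; rewrite [LHS]moran_word_mapE mxE mulrC divfK ?gt_eqF //.
rewrite [X in _ + X](_ : _ = digit_sum (b j) n) ?subrK //.
by apply: eq_bigr => k _; rewrite /sigma !tnth_mktuple.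
Qed.

End MoranDigits.

(** * Covering and packing of Moran sets by Euclidean balls *)

Section MoranGeometry.
Variables (R : realType) (d : nat) (r : nat -> R).
Hypothesis hr : forall n : nat, 0 < r n <= 2^-1.
Local Notation side := (side r).
Local Notation digit_sum := (digit_sum r).

Lemma coord_le_euclidean_norm (x : 'rV[R]_d) j :
  `|x ord0 j| <= euclidean_norm x.
Proof.
rewrite -sqrtr_sqr ler_wsqrtr // (bigD1 j) //= lerDl.
by apply: sumr_ge0 => i _; apply: sqr_ge0.
Qed.

(** The factor [d] instead of its square root costs only a constant later on. *)
Lemma euclidean_norm_le (x : 'rV[R]_d) (a : R) :
  (forall j, `|x ord0 j| <= a) -> euclidean_norm x <= d%:R * a.
Proof.
case: (posnP d) => [d0|d_gt0] xa.
  rewrite /euclidean_norm big1 ?sqrtr0 ?d0 ?mul0r // => j.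
  by have := ltn_ord j; rewrite {2}d0.
have a0 : 0 <= a by apply: le_trans (xa (Ordinal d_gt0)).
have d1 : (1 : R) <= d%:R by rewrite ler1n.
rewrite -(@ger0_norm _ (d%:R * a)) ?mulr_ge0 // -sqrtr_sqr ler_wsqrtr //.
apply: (@le_trans _ _ (\sum_(j < d) a ^+ 2)).
  by apply: ler_sum => j _; rewrite -real_normK ?num_real // lerXn2r ?nnegrE.
rewrite sumr_const card_ord -[leLHS]mulr_natl exprMn.
by apply: ler_wpM2r; rewrite ?sqr_ge0 // expr2 ler_peMl.
Qed.

Lemma digit_sum_stationary b m n :
  (forall k, (m <= k)%N -> b k = false) -> (m <= n)%N ->
  digit_sum b n = digit_sum b m.
Proof.
move=> hb mn; rewrite -(subnK mn); elim: (n - m)%N => [//|k IH].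
by rewrite addSn digit_sumS IH hb ?mul0r ?addr0 // leq_addl.
Qed.

(** At level [n] the relevant endpoints lie between [x - 2 * side n] and [x + side n]; by separation
    there are at most four of them. Each further level at most doubles the list. *)
Lemma digit_sums_near x n m : (n <= m)%N ->
  exists2 s : seq R, size s = (4 * 2 ^ (m - n))%N &
    forall b y, digit_sum b m <= y <= digit_sum b m + side m ->
      `|y - x| <= side n -> digit_sum b m \in s.
Proof.
move=> nm; rewrite -(subnK nm) addnK; elim: (m - n)%N => [|k [s ss IH]].
  pose near (i : nat) := fun b : nat -> bool =>
    x - 2 * side n + i%:R * side n <= digit_sum b n <
    x - 2 * side n + i.+1%:R * side n.
  (* A half-open slot of length [side n] holds at most one endpoint, by [digit_sum_inj]; an empty
     slot gets the dummy value 0. *)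
  have [c cP] : {c : nat -> R & forall i b, near i b -> digit_sum b n = c i}.
    apply: (@choice _ _ (fun i v => forall b, near i b -> digit_sum b n = v)).
    move=> i; have [[b0 nb0]|no] := pselect (exists b, near i b); last first.
      by exists 0 => b nb; case: no; exists b.
    exists (digit_sum b0 n) => b; move: nb0; rewrite /near -natr1.
    move=> /andP[h1 h2] /andP[h3 h4]; apply: (digit_sum_inj hr).
    by rewrite ltr_norml; apply/andP; split; lra.
  exists [:: c 0; c 1; c 2; c 3]%N => // b y /andP[h1 h2].
  rewrite add0n in h1 h2 *; rewrite ler_norml => /andP[h3 h4].
  have s0 := side_gt0 hr n.
  have near4 : [\/ near 0%N b, near 1%N b, near 2%N b | near 3%N b].
    rewrite /near; set z := digit_sum b n in h1 h2 *.
    have [z1|z1] := ltP z (x - side n).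
      by apply: Or41; apply/andP; split; lra.
    have [z2|z2] := ltP z x.
      by apply: Or42; apply/andP; split; lra.
    have [z3|z3] := ltP z (x + side n).
      by apply: Or43; apply/andP; split; lra.
    by apply: Or44; apply/andP; split; lra.
  by case: near4 => /cP ->; rewrite !inE eqxx ?orbT.
(* The left child keeps its parent's endpoint, the right child shifts it. *)
exists (s ++ map (fun e => e + (side (k + n) - side (k + n).+1)) s).
  by rewrite size_cat size_map ss expnS; lia.
move=> b y; rewrite addSn digit_sumS => /andP[h1 h2] hy.
have s0 := side_gt0 hr (k + n).+1; have sh := side_half hr (k + n).
have bs : digit_sum b (k + n) \in s.
  apply: (IH b y) => //; move: h1 h2.
  by case: (b (k + n)%N) => /= h1 h2; apply/andP; split; lra.
rewrite mem_cat; case: (b (k + n)%N) => /=.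
  by rewrite mul1r; apply/orP; right; apply/mapP; exists (digit_sum b (k + n)).
by rewrite mul0r addr0 bs.
Qed.

(** Coordinates are independent: the centres are all vectors formed from the [d] lists of level-[m]
    endpoints, and a level-[m] cube lies within [d%:R * side m] of its corner. *)
Lemma moran_set_cover (x : 'rV[R]_d) n m rad :
  (n <= m)%N -> d%:R * side m < rad ->
  covered_by_balls rad
    (moran_set r `&` [set y | forall j, `|y ord0 j - x ord0 j| <= side n])
    ((4 * 2 ^ (m - n)) ^ d)%N.
Proof.
move=> nm hrad.
have [s sP] : {s : 'I_d -> seq R & forall j, size (s j) = (4 * 2 ^ (m - n))%N /\
    forall b y, digit_sum b m <= y <= digit_sum b m + side m ->
      `|y - x ord0 j| <= side n -> digit_sum b m \in s j}.
  apply: (@choice _ _ (fun j s => size s = (4 * 2 ^ (m - n))%N /\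
    forall b y, digit_sum b m <= y <= digit_sum b m + side m ->
      `|y - x ord0 j| <= side n -> digit_sum b m \in s)).
  by move=> j; have [s ? ?] := digit_sums_near (x ord0 j) nm; exists s.
set N := (4 * 2 ^ (m - n))%N in sP *.
pose c (g : {ffun 'I_d -> 'I_N}) : 'rV[R]_d := \row_j (s j)`_(g j).
have cardN : #|{ffun 'I_d -> 'I_N}| = (N ^ d)%N by rewrite card_ffun !card_ord.
rewrite -cardN; exists (c \o enum_val) => y [/(moran_setP hr)/(_ m)[b hb] hy].
have idx j : (index (digit_sum (b j) m) (s j) < N)%N.
  by have [<- h] := sP j; rewrite index_mem; apply: h (hb j) (hy j).
exists (enum_rank [ffun j => Ordinal (idx j)]) => //=.
rewrite /euclidean_ball /= enum_rankK; apply: le_lt_trans hrad.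
apply: euclidean_norm_le => j; rewrite !mxE ffunE /= nth_index; last first.
  by rewrite -index_mem; have [-> _] := sP j; apply: idx.
by have /andP[h1 h2] := hb j; rewrite ger0_norm; lra.
Qed.

(** The ball contains the corners of all level-[k + n] descendants of the level-[n] cube around [x].
    They are [side (k + n)]-separated, so each covering ball holds at most one. For [k = 0] there is
    a single corner and no constraint on [rad]. *)
Lemma moran_set_pack (x : 'rV[R]_d) n k rho rad N :
  moran_set r x -> d%:R * side n < rho ->
  ((0 < k)%N -> 2 * rad <= side (k + n)) ->
  covered_by_balls rad (moran_set r `&` euclidean_ball x rho) N ->
  ((2 ^ k) ^ d <= N)%N.
Proof.
move=> /(moran_setP hr)/(_ n)[b hb] hrho hrad [c hc].
pose T : finType := {ffun 'I_d -> k.-tuple bool}.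
(* The address follows [x] up to level [n], then the free word [t j]; the default [false] continues
   it for ever, so the corner belongs to the Moran set. *)
pose w (t : T) (j : 'I_d) (i : nat) : bool :=
  if (i < n)%N then b j i else nth false (t j) (i - n).
pose y (t : T) : 'rV[R]_d := \row_j digit_sum (w t j) (k + n).
have w0 t j i : (k + n <= i)%N -> w t j i = false.
  move=> kni; rewrite /w ifF ?nth_default ?size_tuple; lia.
have yC t : moran_set r (y t).
  apply/(moran_setP hr) => p; exists (w t) => j; rewrite mxE.
  have sp := side_gt0 hr p; have skn := side_gt0 hr (k + n).
  have [le_p|/ltnW le_p] := leqP p (k + n).
    have /andP[h1 h2] := digit_sum_nest hr (w t j) le_p.
    by apply/andP; split; lra.
  by rewrite (digit_sum_stationary (w0 t j) le_p); apply/andP; split; lra.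
have yB t : euclidean_ball x rho (y t).
  apply: le_lt_trans hrho; apply: euclidean_norm_le => j; rewrite !mxE.
  have /andP[h1 h2] := digit_sum_nest hr (w t j) (leq_addl k n).
  have skn := side_gt0 hr (k + n).
  have E : digit_sum (w t j) n = digit_sum (b j) n.
    by apply: eq_digit_sum => i lin; rewrite /w lin.
  have /andP[h3 h4] := hb j.
  by rewrite ler_norml; apply/andP; split; lra.
have [g gP] : {g : T -> 'I_N & forall t, euclidean_ball (c (g t)) rad (y t)}.
  apply: (@choice _ _ (fun t i => euclidean_ball (c i) rad (y t))) => t.
  by have [i _ hi] := hc _ (conj (yC t) (yB t)); exists i.
have g_inj : injective g.
  move=> t t' gtt'; apply/ffunP => j; apply: eq_from_tnth => i.
  apply/eqP; apply: contraT => ne.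
  have k0 : (0 < k)%N by apply: leq_ltn_trans (ltn_ord i).
  have sep : side (k + n) <= `|y t ord0 j - y t' ord0 j|.
    rewrite !mxE; apply: (digit_sum_sep hr); exists (i + n)%N.
      by rewrite ltn_add2r.
    by rewrite /w ifF ?addnK -?tnth_nth // ltnNge leq_addl.
  have := coord_le_euclidean_norm (y t - c (g t)) j.
  have := coord_le_euclidean_norm (y t' - c (g t)) j.
  have := gP t; have := gP t'; rewrite /euclidean_ball /= -gtt'.
  move: (euclidean_norm _) (euclidean_norm _) => n1 n2 l1 l2.
  rewrite !(mxE, ler_norml) in sep *; move=> /andP[a1 a2] /andP[a3 a4].
  have := hrad k0; move: sep; rewrite ler_normr => /orP[]; lra.
have := leq_card g g_inj; rewrite card_ord => /(leq_trans _); apply.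
by rewrite card_ffun card_tuple card_bool card_ord.
Qed.

End MoranGeometry.

(** * From a growth function to contraction ratios *)

Section CountingFunction.
Variables (R : realType) (d : nat) (f : R -> R).
Hypothesis d_gt0 : (0 < d)%N.
Hypothesis f_nd : forall t T : R, t <= T -> f t <= f T.
Hypothesis f_eq0 : forall t : R, t <= 0 -> f t = 0.
Hypothesis f_lip : forall t T : R, t <= T -> f T - f t <= d%:R * (T - t).
Hypothesis f_unbounded : forall M : R, exists t : R, M <= f t.

(** Logarithm of the number of children of a cube. *)
Let D : R := d%:R * ln 2.

Lemma ln2_gt0 : 0 < ln 2 :> R.
Proof. by rewrite ln_gt0 // ltr1n. Qed.

Lemma levelheight_gt0 : 0 < D.
Proof. by rewrite mulr_gt0 ?ltr0n ?ln2_gt0. Qed.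

Lemma expR_natM_ln2 k : expR (k%:R * ln 2) = 2 ^+ k :> R.
Proof. by rewrite expRM_natl lnK // posrE. Qed.

Lemma lipschitz_attains (v : R) : 0 <= v -> exists t, f t = v.
Proof.
move=> v0; have [X vX] := f_unbounded v.
have [X0|X0] := leP X 0.
  by exists X; apply/eqP; rewrite eq_le vX andbT f_eq0.
have fc : continuous f.
  move=> x; apply/cvgrPdist_le => e e0.
  have d1 : 0 < d%:R :> R by rewrite ltr0n.
  have ed0 : 0 < e / d%:R by rewrite divr_gt0.
  near=> y.
  have : `|x - y| <= e / d%:R.
    by near: y; have /cvgrPdist_le/(_ _ ed0) := @cvg_id _ (nbhs x).
  rewrite ler_pdivlMr // => xy; apply: le_trans xy.
  have [le_xy|/ltW le_yx] := leP x y.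
    rewrite distrC ger0_norm ?subr_ge0 ?f_nd // mulrC distrC.
    by rewrite ger0_norm ?subr_ge0 // f_lip.
  rewrite ger0_norm ?subr_ge0 ?f_nd // mulrC.
  by rewrite ger0_norm ?subr_ge0 // f_lip.
have [||c _ fcv] := @IVT R f 0 X v (ltW X0).
- exact: continuous_subspaceT.
- by rewrite ge_min le_max vX f_eq0 // v0 orbT.
by exists c.
Unshelve. all: by end_near. Qed.

(** Choose [tau n] where [f] takes the value [n%:R * D]. Since [f] is [d]-Lipschitz, consecutive
    times differ by at least [ln 2], which says that the ratios are at most 1/2. *)
Lemma exists_ratios : exists r : nat -> R,
  (forall n, 0 < r n <= 2^-1) /\
  exists2 tau : nat -> R, forall n, side r n = expR (- tau n) &
    forall n, f (tau n) = n%:R * D.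
Proof.
have [tau0 tau0P] : {tau : nat -> R & forall n, f (tau n) = n%:R * D}.
  apply: (@choice _ _ (fun n t => f t = n%:R * D)) => n.
  by apply: lipschitz_attains; rewrite mulr_ge0 // ltW ?levelheight_gt0.
(* The chosen preimage of 0 may be another zero of [f], whereas [side r 0 = 1] requires time 0. *)
pose tau n := if n is 0%N then 0 else tau0 n.
have tauP n : f (tau n) = n%:R * D.
  by case: n => [|n]; rewrite ?tau0P //= f_eq0 // mul0r.
exists (fun n => expR (tau n - tau n.+1)); split.
  move=> n; rewrite expR_gt0 andTb.
  have fS : f (tau n.+1) - f (tau n) = D.
    by rewrite !tauP -natr1 mulrDl mul1r addrAC subrr add0r.
  have le_tau : tau n <= tau n.+1.
    rewrite leNgt; apply/negP => /ltW/f_nd; have := levelheight_gt0; lra.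
  have := f_lip le_tau; rewrite fS /D ler_pM2l ?ltr0n // => gap.
  rewrite (_ : 2^-1 = expR (- ln 2)); last by rewrite expRN lnK ?posrE.
  by rewrite ler_expR; lra.
exists tau => // n; rewrite /side -expR_sum; congr expR.
elim: n => [|n IH]; first by rewrite big_ord0 /= oppr0.
rewrite big_ord_recr IH; exact: addKr.
Qed.

(** * Covering numbers, spectrum and dimension in terms of the growth function *)

Section Counting.
Variables (r : nat -> R) (tau : nat -> R).
Hypothesis hr : forall n, 0 < r n <= 2^-1.
Hypothesis sideE : forall n, side r n = expR (- tau n).
Hypothesis f_tau : forall n, f (tau n) = n%:R * D.

Let C := @moran_set R d r.

Lemma f_ge0 t : 0 <= f t.
Proof.
have [t0|/ltW t0] := leP t 0; first by rewrite f_eq0.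
by rewrite -(f_eq0 (lexx 0)) f_nd.
Qed.

Let q (t : R) : nat := Num.truncn (f t / D).

Lemma level_bounds t : (q t)%:R * D <= f t < (q t).+1%:R * D.
Proof.
have D0 := levelheight_gt0.
have /truncn_itv/andP[h1 h2] : 0 <= f t / D by rewrite divr_ge0 ?f_ge0 ?ltW.
by rewrite -ler_pdivlMr // -ltr_pdivrMr // h1 h2.
Qed.

(** The hypothesis is strict because [f] has plateaus: [f (tau n) = f t] does not tell which of
    [tau n] and [t] is larger. *)
Lemma expR_lt_side n t : n%:R * D < f t -> expR (- t) < side r n.
Proof.
rewrite -f_tau sideE ltr_expR ltrN2 => h.
by rewrite ltNge; apply/negP => /f_nd; rewrite leNgt h.
Qed.

(** Level [n] already has side at most [expR (- t)]; the [d] further levels gain a factor [2 ^+ d],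
    which exceeds [d]. *)
Lemma diameter_lt n t : (q t < n)%N -> d%:R * side r (d + n) < expR (- t).
Proof.
move=> qn; have sn := side_gt0 hr (d + n).
apply: (@lt_le_trans _ _ (2 ^+ d * side r (d + n))).
  by rewrite ltr_pM2r // -natrX ltr_nat ltn_expl.
apply: le_trans (side_addl hr d n) _.
rewrite sideE ler_expR lerN2 leNgt; apply/negP => /ltW/f_nd.
have /andP[_ h] := level_bounds t; rewrite leNgt f_tau => /negP; apply.
by apply: lt_le_trans h _; rewrite ler_pM2r ?levelheight_gt0 // ler_nat.
Qed.

Lemma moran_set_sub_cube (x : 'rV[R]_d) j : C x -> 0 <= x ord0 j <= 1.
Proof.
move=> /(moran_setP hr)/(_ 0%N)[b /(_ j)].
by rewrite digit_sum0 side0 add0r.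
Qed.

(** The four slots per coordinate, and up to [d + 4] levels lost by rounding in either of the two
    bounds below. *)
Definition counting_const : R := 4 ^+ d * expR ((d + 4)%:R * D).

Lemma counting_const_gt0 : 0 < counting_const.
Proof. by rewrite mulr_gt0 ?exprn_gt0 ?expR_gt0. Qed.

Lemma covering_number_le x t T : C x -> t <= T ->
  (covering_number (expR (- T)) (C `&` euclidean_ball x (expR (- t)))
   <= (counting_const * expR (f T - f t))%:E)%E.
Proof.
move=> Cx tT; have D0 := levelheight_gt0.
(* Level [n] is one step early, so that for [n > 0] its side exceeds [expR (- t)]; level [m] is late
   enough for [diameter_lt]. *)
set n := (q t).-1; pose m := (d + (q T).+1)%N.
have qtT : (q t <= q T)%N.
  by apply: le_truncn; rewrite ler_pM2r ?invr_gt0 // f_nd.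
have nm : (n <= m)%N by rewrite /n /m; lia.
have cov := moran_set_cover hr x nm (diameter_lt (ltnSn (q T))).
have {cov} cov : covered_by_balls (expR (- T))
    (C `&` euclidean_ball x (expR (- t))) ((4 * 2 ^ (m - n)) ^ d)%N.
  have [c cP] := cov; exists c => y [Cy By]; apply: cP; split => // j.
  (* At level 0 the slab of half-width 1 contains the whole set, whatever [t] is. *)
  have [n0|n0] := posnP n.
    rewrite n0 side0; have /andP[? ?] := moran_set_sub_cube j Cx.
    have /andP[? ?] := moran_set_sub_cube j Cy.
    by rewrite ler_norml; apply/andP; split; lra.
  have := coord_le_euclidean_norm (y - x) j; rewrite !mxE => /le_trans; apply.
  apply: ltW; apply: lt_trans By _; apply: expR_lt_side.
  have /andP[h _] := level_bounds t; apply: lt_le_trans h.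
  by rewrite ltr_pM2r // ltr_nat /n; lia.
apply: le_trans (ereal_inf_lbound _) _.
  by exists ((4 * 2 ^ (m - n)) ^ d)%N.
rewrite lee_fin natrX natrM exprMn /counting_const -mulrA.
apply: ler_wpM2l; first by rewrite exprn_ge0.
rewrite natrX -exprM -expR_natM_ln2 -expRD ler_expR.
have -> : ((m - n) * d)%:R * ln 2 = (m - n)%:R * D by rewrite natrM mulrA.
have /andP[hT _] := level_bounds T; have /andP[_ ht] := level_bounds t.
rewrite natrB // mulrBl /m !natrD -!natr1 in ht *.
have : (q t)%:R * D <= (n%:R + 1) * D.
  by rewrite ler_pM2r // natr1 ler_nat /n; lia.
move: hT ht; rewrite !mulrDl !mul1r; lra.
Qed.

Lemma le_covering_number x t T : C x ->
  ((counting_const^-1 * expR (f T - f t))%:E <=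
   covering_number (expR (- T)) (C `&` euclidean_ball x (expR (- t))))%E.
Proof.
move=> Cx; have D0 := levelheight_gt0.
apply: le_ereal_inf_tmp => _ [N /= cov <-]; rewrite lee_fin.
(* Level [n] fits inside the ball; stopping at level [(q T).-2] leaves the factor 2 required for
   packing. If [T] is too close to [t] or below it, truncated subtraction gives [k = 0] and the
   bound [1 <= N]. *)
pose n := (d + (q t).+1)%N; pose k := ((q T).-2 - n)%N.
have hk : (0 < k)%N -> 2 * expR (- T) <= side r (k + n).
  move=> k0; have -> : (k + n = (q T).-2)%N by rewrite /k in k0 *; lia.
  apply: le_trans (side_half hr _); rewrite ler_pM2l // ltW // expR_lt_side //.
  have /andP[h _] := level_bounds T; apply: lt_le_trans h.
  by rewrite ltr_pM2r // ltr_nat; rewrite /k in k0; lia.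
have := moran_set_pack hr Cx (diameter_lt (ltnSn (q t))) hk cov.
rewrite -(ler_nat R) => /(le_trans _); apply.
rewrite natrX natrX -exprM -expR_natM_ln2.
have -> : (k * d)%:R * ln 2 = k%:R * D by rewrite natrM mulrA.
rewrite mulrC ler_pdivrMr ?counting_const_gt0 // /counting_const mulrCA -expRD.
have exp_le : expR (f T - f t) <= expR (k%:R * D + (d + 4)%:R * D).
  rewrite ler_expR.
  have /andP[_ hT] := level_bounds T; have /andP[ht _] := level_bounds t.
  have : (q T)%:R * D <= (k%:R + n%:R + 2) * D.
    by rewrite ler_pM2r // -!natrD ler_nat /k; lia.
  move: hT ht; rewrite /n !natrD -!natr1 !mulrDl !mul1r; lra.
apply: le_trans exp_le _; rewrite ler_peMl ?expR_ge0 //.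
by rewrite exprn_ege1 // ler1n.
Qed.

Lemma moran_set_nonempty : C 0.
Proof.
apply/(moran_setP hr) => n; exists (fun _ _ => false) => j.
rewrite mxE /digit_sum big1 ?add0r ?lexx ?ltW ?side_gt0 // => k _.
by rewrite mul0r.
Qed.

Lemma spectrum_moran_set (theta s : R) : 0 < theta < 1 ->
  (forall e, 0 < e -> exists M, forall t, 0 <= t ->
     f (t / theta) - f t <= (s + e) * (t / theta - t) + M) ->
  (forall a M, a < s -> exists2 t, 0 <= t &
     a * (t / theta - t) + M < f (t / theta) - f t) ->
  assouad_spectrum theta C = s%:E.
Proof.
move=> /andP[th0 th1] upper lower.
have K0 := counting_const_gt0.
have scale t : expR (- t) `^ theta^-1 = expR (- (t / theta)).
  by rewrite -expRM mulNr.
have ratio t a : (expR (- t) / expR (- (t / theta))) `^ a =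
    expR (a * (t / theta - t)).
  by rewrite -expRN opprK -expRD -expRM; congr expR; ring.
have le_scale t : 0 <= t -> t <= t / theta.
  by move=> t0; rewrite ler_pdivlMr // ler_piMr // ltW.
apply/eqP; rewrite eq_le; apply/andP; split.
  apply/lee_addgt0Pr => e e0; apply: ereal_inf_lbound => /=.
  exists (s + e) => //; have [M MP] := upper e e0.
  exists (counting_const * expR M); first by rewrite mulr_gt0 ?expR_gt0.
  move=> delta x /andP[del0 del1] Cx.
  have [t dE] : exists t, delta = expR (- t).
    by exists (- ln delta); rewrite opprK lnK.
  have t0 : 0 <= t by move: del1; rewrite dE -expR0 ler_expR; lra.
  rewrite dE scale ratio.
  apply: le_trans (covering_number_le Cx (le_scale t t0)) _.
  rewrite lee_fin -mulrA ler_pM2l // -expRD ler_expR.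
  by have := MP t t0; lra.
apply: le_ereal_inf_tmp => _ [a [c c0 cP] <-]; rewrite lee_fin leNgt.
apply/negP => as_lt.
(* This surplus beats both the constant [c] of the assumed bound and the loss in
   [le_covering_number]. *)
have [t t0 ht] := lower a (ln (c * counting_const)) as_lt.
have := cP (expR (- t)) 0; rewrite expR_gt0 -{1}expR0 ler_expR scale ratio.
move=> /(_ _ moran_set_nonempty) /=; have -> : - t <= 0 by lra.
move=> /(_ isT) hc.
have := le_trans (le_covering_number t (t / theta) moran_set_nonempty) hc.
rewrite lee_fin mulrC ler_pdivrMr // leNgt => /negP; apply.
have -> : c * expR (a * (t / theta - t)) * counting_const =
  expR (a * (t / theta - t) + ln (c * counting_const)).
  by rewrite expRD lnK ?posrE ?(mulr_gt0 c0 K0) //; ring.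
by rewrite ltr_expR.
Qed.

(** As for the spectrum, but with two independent times; radii above 1 occur, so the times may be
    negative. *)
Lemma dimension_moran_set (s : R) : 0 <= s ->
  (forall e, 0 < e -> exists M, forall t T, t <= T ->
     f T - f t <= (s + e) * (T - t) + M) ->
  (forall a M, a < s -> exists t T,
     t <= T /\ a * (T - t) + M < f T - f t) ->
  assouad_dimension C = s%:E.
Proof.
move=> s0 upper lower.
have K0 := counting_const_gt0.
have ratio t T a : (expR (- t) / expR (- T)) `^ a = expR (a * (T - t)).
  by rewrite -expRN opprK -expRD -expRM; congr expR; ring.
apply/eqP; rewrite eq_le; apply/andP; split.
  apply/lee_addgt0Pr => e e0; apply: ereal_inf_lbound => /=.
  exists (s + e) => //; split; first by rewrite addr_ge0 // ltW.
  have [M MP] := upper e e0.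
  exists (counting_const * expR M); first by rewrite mulr_gt0 ?expR_gt0.
  move=> small big x small0 smallbig Cx.
  have big0 : 0 < big by apply: lt_le_trans smallbig.
  have [T TE] : exists T, small = expR (- T).
    by exists (- ln small); rewrite opprK lnK.
  have [t tE] : exists t, big = expR (- t).
    by exists (- ln big); rewrite opprK lnK.
  have tT : t <= T by move: smallbig; rewrite TE tE ler_expR lerN2.
  rewrite TE tE ratio; apply: le_trans (covering_number_le Cx tT) _.
  rewrite lee_fin -mulrA ler_pM2l // -expRD ler_expR.
  by have := MP t T tT; lra.
apply: le_ereal_inf_tmp => _ [a [_ [c c0 cP]] <-]; rewrite lee_fin leNgt.
apply/negP => as_lt.
have [t [T [tT hT]]] := lower a (ln (c * counting_const)) as_lt.
have := cP (expR (- T)) (expR (- t)) 0; rewrite expR_gt0 ler_expR lerN2 ratio.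
move=> /(_ isT tT moran_set_nonempty) hc.
have := le_trans (le_covering_number t T moran_set_nonempty) hc.
rewrite lee_fin mulrC ler_pdivrMr // leNgt => /negP; apply.
have -> : c * expR (a * (T - t)) * counting_const =
  expR (a * (T - t) + ln (c * counting_const)).
  by rewrite expRD lnK ?posrE ?(mulr_gt0 c0 K0) //; ring.
by rewrite ltr_expR.
Qed.

End Counting.
End CountingFunction.

(** * Consequences of the class inequality *)

Section ClassA.
Variables (R : realType) (d : nat) (phi : R -> R).
Hypothesis hphi : classA d phi.

Lemma classA_ge0 x : 0 < x < 1 -> 0 <= phi x.
Proof. by move=> /(proj1 hphi)/andP[]. Qed.

Lemma classA_le x : 0 < x < 1 -> phi x <= d%:R.
Proof. by move=> /(proj1 hphi)/andP[]. Qed.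

(** With [x = theta ^+ n.+1], the class inequality for [x * theta < x] bounds [phi (x * theta)] by a
    weighted mean of [phi x] and [phi theta]. *)
Lemma classA_exp theta n : 0 < theta < 1 -> phi (theta ^+ n.+1) <= phi theta.
Proof.
move=> /andP[t0 t1]; elim: n => [|n IH]; first by rewrite expr1.
have x0 : 0 < theta ^+ n.+1 by rewrite exprn_gt0.
have x1 : theta ^+ n.+1 < 1 by rewrite exprn_ilt1 // ltW.
rewrite exprSr; set x := theta ^+ n.+1 in IH x0 x1 *.
have l0 : 0 < x * theta by rewrite mulr_gt0.
have lx : x * theta < x by rewrite gtr_pMr.
have /andP[_] := (proj2 hphi) _ _ l0 lx x1.
rewrite [x * theta / x]mulrAC divff ?gt_eqF // mul1r => h.
have : (1 - x) * phi x <= (1 - x) * phi theta by rewrite ler_pM2l ?subr_gt0.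
by move=> h'; rewrite -(@ler_pM2l _ (1 - x * theta)); lra.
Qed.

(* Some power of theta lies in the interval [theta * l, l]. *)
Lemma classA_left_bound l theta : 0 < l < 1 -> 0 < theta < 1 ->
  (1 - l) * phi l <= (1 - theta * l) * phi theta.
Proof.
move=> /andP[l0 l1] /andP[t0 t1].
have ex : exists n, theta ^+ n <= l.
  have /cvg_expr/cvgrPdist_le/(_ l l0)[n _ /(_ n (leqnn n))] : `|theta| < 1.
    by rewrite ger0_norm // ltW.
  by rewrite /= sub0r normrN ger0_norm ?exprn_ge0 ?(ltW t0) // => h; exists n.
case: (ex_minnP ex) => [[|n]] hn min_n; first by rewrite expr0 in hn; lra.
have ln : l < theta ^+ n.
  by rewrite ltNge; apply/negP => /min_n; rewrite ltnn.
have x0 : 0 < theta ^+ n.+1 by rewrite exprn_gt0.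
have phin := classA_exp n (introT andP (conj t0 t1)).
have phi0 := classA_ge0 (introT andP (conj t0 t1)).
have tl : theta * l <= theta ^+ n.+1 by rewrite exprS ler_pM2l // ltW.
set x := theta ^+ n.+1 in hn x0 phin tl.
have le1 : (1 - x) * phi x <= (1 - x) * phi theta.
  by rewrite ler_wpM2l //; lra.
have le2 : (1 - x) * phi theta <= (1 - theta * l) * phi theta.
  by rewrite ler_wpM2r //; lra.
have le3 : (1 - l) * phi l <= (1 - x) * phi x.
  move: hn; rewrite le_eqVlt => /predU1P[->//|xl].
  by have /andP[] := (proj2 hphi) _ _ x0 xl l1; rewrite subr_ge0.
lra.
Qed.

(** The limit is the supremum of [phi], although [phi] need not be monotone: [classA_left_bound]
    gives [(1 - l) * (phi l - phi t) <= (1 - t) * l * phi t], which vanishes as [t] tends to 1. *)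
Lemma classA_le_value_at1 x : 0 < x < 1 -> phi x <= value_at1 phi.
Proof.
pose V := [set phi t | t in [set t : R | 0 < t < 1]].
have V_ub : has_ubound V.
  by exists d%:R => _ [t ht <-]; apply: classA_le.
have half01 : 0 < (2^-1 : R) < 1 by apply/andP; split; lra.
have V_sup : has_sup V by split => //; exists (phi 2^-1), 2^-1.
have phi_sup t : 0 < t < 1 -> phi t <= sup V.
  by move=> ht; apply: ub_le_sup => //; exists t.
suff -> : value_at1 phi = sup V by apply: phi_sup.
apply/cvg_lim => //; apply/cvgrPdist_le => e e0.
have e2 : 0 < e / 2 by lra.
have [_ [l l01 <-] hl] := sup_adherent e2 V_sup.
have /andP[l0 l1] := l01.
(* Chosen so that [1 - t < eta] makes the error above at most [(1 - l) * (e / 2)]; adding 1 to [d]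
   keeps the denominator positive. *)
pose eta := (1 - l) * (e / 2) / (d%:R + 1).
have d1 : (0 : R) < d%:R + 1 by rewrite ltr_wpDl.
have eta0 : 0 < eta by rewrite divr_gt0 // mulr_gt0 // subr_gt0.
near=> t.
have t01 : 0 < t < 1.
  apply/andP; split; first by near: t; apply: nbhs_left_gt.
  by near: t; apply: nbhs_left_lt.
have t_eta : 1 - eta < t by near: t; apply: nbhs_left_gt; lra.
have /andP[t0 t1] := t01.
have := phi_sup t t01; rewrite -subr_ge0 => /ger0_norm ->.
have tb := classA_left_bound l01 t01.
have phid := classA_le t01; have phi0 := classA_ge0 t01.
have small : (1 - t) * (d%:R + 1) <= (1 - l) * (e / 2).
  by rewrite -ler_pdivlMr // -/eta; lra.
have : (1 - l) * (phi l - phi t) <= (1 - l) * (e / 2).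
  apply: le_trans small.
  have : (1 - t) * (l * phi t) <= (1 - t) * (d%:R + 1).
    rewrite ler_wpM2l ?subr_ge0 ?(ltW t1) //.
    by apply: (@le_trans _ _ (1 * phi t)); [apply: ler_wpM2r|]; lra.
  lra.
rewrite ler_pM2l ?subr_gt0 //; lra.
Unshelve. all: by end_near. Qed.

(** The function [beta] of the overview, cut off at 1 so that it contributes nothing after the end
    of a window. *)
Definition defect (x : R) : R := if x < 1 then (1 - x) * phi x else 0.

Lemma defect_eq0 x : 1 <= x -> defect x = 0.
Proof. by rewrite /defect ltNge => ->. Qed.

Lemma defect_ge0 x : 0 < x -> 0 <= defect x.
Proof.
rewrite /defect => x0; case: ltP => // x1.
by rewrite mulr_ge0 ?subr_ge0 ?(ltW x1) // classA_ge0 // x0.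
Qed.

(** Below 1 this is the class inequality. For [t >= 1] it follows from monotonicity: [l / t <= l],
    so [defect l <= defect (l / t)]. *)
Lemma defect_subadd l t : 0 < l -> l <= t ->
  0 <= defect l - defect t <= t * defect (l / t).
Proof.
move=> l0 lt; have t0 : 0 < t by apply: lt_le_trans lt.
have below1 x y : 0 < x -> x <= y -> y < 1 ->
    0 <= defect x - defect y <= y * defect (x / y).
  move=> x0; rewrite le_eqVlt => /predU1P[<- _|xy y1].
    by rewrite subrr divff ?gt_eqF // (defect_eq0 (lexx 1)) mulr0 lexx.
  have y0 : 0 < y by apply: lt_trans xy.
  rewrite /defect y1 (lt_trans xy y1) ltr_pdivrMr // mul1r xy.
  have := (proj2 hphi) _ _ x0 xy y1.
  suff -> : y * ((1 - x / y) * phi (x / y)) = (y - x) * phi (x / y) by [].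
  by rewrite mulrA mulrBr mulr1 mulrCA divff ?gt_eqF // mulr1.
have [t1|t1] := ltP t 1; first exact: below1.
have lt0 : 0 < l / t by rewrite divr_gt0.
rewrite (defect_eq0 t1) subr0 defect_ge0 //=.
have le_def : defect (l / t) <= t * defect (l / t).
  by rewrite ler_peMl // defect_ge0.
apply: le_trans le_def.
have [l1|l1] := ltP l 1; last by rewrite (defect_eq0 l1) defect_ge0.
have ltl : l / t <= l by rewrite ler_pdivrMr // ler_peMr // ltW.
by have /andP[] := below1 _ _ lt0 ltl l1; rewrite subr_ge0.
Qed.

End ClassA.

(** * Construction of the growth function and its increments *)

Section Profile.
Variables (R : realType) (d : nat) (beta : R -> R) (alpha : R).
Hypothesis d_gt0 : (0 < d)%N.
Hypothesis alpha_ge0 : 0 <= alpha.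
Hypothesis alpha_le : alpha <= d%:R.
Hypothesis beta_ge0 : forall x, 0 < x -> 0 <= beta x.
Hypothesis beta_eq0 : forall x, 1 <= x -> beta x = 0.
Hypothesis beta_subadd : forall l t, 0 < l -> l <= t ->
  0 <= beta l - beta t <= t * beta (l / t).
Hypothesis beta_le : forall x, 0 < x < 1 -> beta x <= alpha * (1 - x).

(** The factor [k'.+2 ^ 2] does two things: it puts a ratio of at least [k'.+2] between a burst end
    and the next window, and it makes bursts short compared with their starting times. *)
Fixpoint window_start_nat (k : nat) : nat :=
  if k is k'.+1 then (k'.+2 ^ 2 * (window_start_nat k').+1)%N else 1.

Definition window_start (k : nat) : R := (window_start_nat k)%:R.
Definition window_end (k : nat) : R := k.+1%:R * window_start k.
Definition burst_end (k : nat) : R := window_end k + k.+1%:R.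
Definition slope (k : nat) : R := Num.max alpha k.+1%:R^-1.

Definition clamp (k : nat) (u : R) : R :=
  Num.min (burst_end k) (Num.max (window_start k) u).

(** Normalised to vanish at [window_start k]. The first term is constant after [window_end k], where
    the linear burst takes over. *)
Definition profile (k : nat) (u : R) : R :=
  window_end k *
    (beta (window_start k / window_end k) - beta (u / window_end k)) +
  slope k * Num.max 0 (u - window_end k).

Definition piece (k : nat) (u : R) : R := profile k (clamp k u).

(** In effect the sum over all windows: [window_start k >= k.+1], so the omitted pieces have not
    begun at time [u]. *)
Definition exponent (u : R) : R := \sum_(k < (Num.truncn u).+1) piece k u.

Local Notation S := window_start.
Local Notation T := window_end.
Local Notation B := burst_end.

Lemma window_start_sqr k : k.+1%:R ^+ 2 <= S k.
Proof.
rewrite /S -natrX ler_nat; case: k => [//|k] /=.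
by rewrite leq_pmulr.
Qed.

Lemma window_start_ge k : k.+1%:R <= S k.
Proof.
apply: le_trans (window_start_sqr k).
by rewrite expr2 ler_peMl // ler1n.
Qed.

Lemma window_start_gt0 k : 0 < S k.
Proof. by apply: lt_le_trans (window_start_ge k). Qed.

Lemma window_start_le_end k : S k <= T k.
Proof. by rewrite /T ler_peMl ?(ltW (window_start_gt0 k)) // ler1n. Qed.

Lemma window_end_gt0 k : 0 < T k.
Proof. exact: lt_le_trans (window_start_gt0 k) (window_start_le_end k). Qed.

Lemma window_end_lt k : T k < B k.
Proof. by rewrite ltrDl. Qed.

Lemma burst_end_gt0 k : 0 < B k.
Proof. exact: lt_trans (window_end_gt0 k) (window_end_lt k). Qed.

Lemma burst_end_next k : k.+2%:R * B k <= S k.+1.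
Proof.
rewrite /B /T /S -[X in _ + X]mulr1 -mulrDr natr1 -!natrM ler_nat /=; nia.
Qed.

Lemma burst_end_le_next k : B k <= S k.+1.
Proof.
apply: le_trans (burst_end_next k).
by rewrite ler_peMl ?(ltW (burst_end_gt0 k)) // ler1n.
Qed.

Lemma window_start_homo : {homo S : k l / (k <= l)%N >-> k <= l}.
Proof.
apply: homo_leq => [x //|y x z|k]; first exact: le_trans.
apply: le_trans (burst_end_le_next k).
exact: le_trans (window_start_le_end k) (ltW (window_end_lt k)).
Qed.

Lemma burst_end_le_start k l : (k < l)%N -> B k <= S l.
Proof.
by move=> kl; apply: le_trans (burst_end_le_next k) (window_start_homo kl).
Qed.

Lemma burst_end_homo k l : (k <= l)%N -> B k <= B l.
Proof.
rewrite leq_eqVlt => /predU1P[->//|/burst_end_le_start/le_trans]; apply.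
exact: le_trans (window_start_le_end l) (ltW (window_end_lt l)).
Qed.

Lemma slope_bounds k : [/\ alpha <= slope k, k.+1%:R^-1 <= slope k,
  slope k <= d%:R & slope k <= alpha + k.+1%:R^-1].
Proof.
have i0 : 0 < k.+1%:R^-1 :> R by rewrite invr_gt0.
have i1 : k.+1%:R^-1 <= 1 :> R by rewrite invf_le1 ?ler1n.
have d1 : 1 <= d%:R :> R by rewrite ler1n.
rewrite /slope; move: (k.+1%:R^-1) i0 i1 => i i0 i1.
have a0 := alpha_ge0; have ad := alpha_le.
by case: (leP alpha i) => h; split; lra.
Qed.

Lemma window_le_burst k : S k <= B k.
Proof. exact: le_trans (window_start_le_end k) (ltW (window_end_lt k)). Qed.

Lemma clamp_in k u : S k <= clamp k u <= B k.
Proof.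
have h := window_le_burst k; rewrite /clamp.
by case: (leP (S k) u) => h1; case: (leP (B k) _) => h2;
   apply/andP; split; lra.
Qed.

Lemma clamp_id k u : S k <= u <= B k -> clamp k u = u.
Proof.
by move=> /andP[h1 h2]; rewrite /clamp (max_idPr h1) (min_idPr h2).
Qed.

Lemma clamp_nd k u v : u <= v -> clamp k u <= clamp k v.
Proof. by move=> uv; rewrite /clamp le_min2 // le_max2. Qed.

Lemma clamp_le_start k u : u <= S k -> clamp k u = S k.
Proof.
by move=> h; rewrite /clamp (max_idPl h) (min_idPr (window_le_burst k)).
Qed.

Lemma clamp_ge_end k u : B k <= u -> clamp k u = B k.
Proof.
by move=> h; rewrite /clamp (min_idPl _) // le_max h orbT.
Qed.

(** This is [beta_subadd] rescaled by [T k]; the quotient [u / v] is scale-free, so the bound does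
    not depend on the window. *)
Lemma window_part_bounds k u v : 0 < u -> u <= v ->
  0 <= T k * (beta (u / T k) - beta (v / T k)) <= v * beta (u / v).
Proof.
move=> u0 uv; have T0 := window_end_gt0 k.
have v0 : 0 < v by apply: lt_le_trans uv.
have /andP[h1 h2] : 0 <= beta (u / T k) - beta (v / T k)
    <= v / T k * beta (u / T k / (v / T k)).
  by apply: beta_subadd; [rewrite divr_gt0|rewrite ler_pM2r ?invr_gt0].
rewrite mulr_ge0 ?(ltW T0) //=.
have -> : v * beta (u / v) = T k * (v / T k * beta (u / T k / (v / T k))).
  rewrite invf_div [u / T k * _]mulrA divfK ?gt_eqF //.
  by rewrite mulrA [T k * _]mulrC divfK ?gt_eqF.
by rewrite ler_pM2l.
Qed.

Lemma burst_part_bounds k u v : u <= v -> v <= B k ->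
  0 <= slope k * Num.max 0 (v - T k) - slope k * Num.max 0 (u - T k)
    <= d%:R * k.+1%:R.
Proof.
move=> uv vB; have [a1 a2 a3 a4] := slope_bounds k.
have s0 : 0 <= slope k by apply: le_trans a1.
rewrite -mulrBr; set w := Num.max 0 (v - _) - _.
have /andP[w0 w1] : 0 <= w <= k.+1%:R.
  have k0 : (0 : R) <= k.+1%:R by [].
  rewrite /burst_end in vB; rewrite /w.
  by case: (leP 0 (v - _)) => h1; case: (leP 0 (u - _)) => h2;
     apply/andP; split; lra.
by rewrite mulr_ge0 //= ler_pM.
Qed.

Lemma profile_increment k u v :
  profile k v - profile k u =
  T k * (beta (u / T k) - beta (v / T k)) +
  (slope k * Num.max 0 (v - T k) - slope k * Num.max 0 (u - T k)).
Proof. by rewrite /profile; ring. Qed.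

Lemma profile_nd k u v : S k <= u -> u <= v -> v <= B k ->
  profile k u <= profile k v.
Proof.
move=> Su uv vB; rewrite -subr_ge0 profile_increment //.
have u0 : 0 < u by apply: lt_le_trans Su; apply: window_start_gt0.
have /andP[? _] := window_part_bounds k u0 uv.
by have /andP[? _] := burst_part_bounds uv vB; apply: addr_ge0.
Qed.

Lemma profile_le_beta k u v : S k <= u -> u <= v -> v <= B k ->
  profile k v - profile k u <= v * beta (u / v) + d%:R * k.+1%:R.
Proof.
move=> Su uv vB; rewrite profile_increment //.
have u0 : 0 < u by apply: lt_le_trans Su; apply: window_start_gt0.
have /andP[_ ?] := window_part_bounds k u0 uv.
by have /andP[_ ?] := burst_part_bounds uv vB; apply: lerD.
Qed.

(** Inside the window [v * beta (u / v) <= alpha * (v - u)] by [beta_le], and [alpha <= slope k]. An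
    interval straddling [T k] is split there. *)
Lemma profile_lip k u v : S k <= u -> u <= v -> v <= B k ->
  profile k v - profile k u <= slope k * (v - u).
Proof.
move=> Su uv vB; rewrite profile_increment //.
have u0 : 0 < u by apply: lt_le_trans Su; apply: window_start_gt0.
have v0 : 0 < v by apply: lt_le_trans uv.
have T0 := window_end_gt0 k.
have [a1 _ _ _] := slope_bounds k.
have [Tu|uT] := leP (T k) u.
  have Tv := le_trans Tu uv.
  rewrite !beta_eq0 ?ler_pdivlMr ?mul1r // subrr mulr0 add0r.
  by rewrite !max_r ?subr_ge0 //; lra.
rewrite (@max_l _ _ 0 (u - _)) ?subr_le0 ?(ltW uT) // mulr0 subr0.
have [vT|Tv] := leP v (T k).
  rewrite max_l ?subr_le0 // mulr0 addr0.
  have /andP[_ /le_trans] := window_part_bounds k u0 uv; apply.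
  apply: (@le_trans _ _ (alpha * (v - u))); last first.
    by rewrite ler_wpM2r ?subr_ge0.
  have [uv'|vu] := ltP u v; last first.
    by rewrite beta_eq0 ?ler_pdivlMr ?mul1r // mulr0 mulr_ge0 ?subr_ge0.
  have /beta_le : 0 < u / v < 1 by rewrite divr_gt0 // ltr_pdivrMr ?mul1r.
  rewrite -(ler_pM2l v0) => /le_trans; apply.
  by rewrite mulrCA mulrBr mulr1 mulrCA mulfV ?gt_eqF // mulr1.
rewrite max_r ?subr_ge0 ?(ltW Tv) // (@beta_eq0 (v / T k)); last first.
  by rewrite ler_pdivlMr // mul1r ltW.
have /beta_le : 0 < u / T k < 1 by rewrite divr_gt0 // ltr_pdivrMr ?mul1r.
rewrite -(ler_pM2l T0) subr0 => h1.
have h2 : T k * (alpha * (1 - u / T k)) = alpha * (T k - u).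
  by rewrite mulrCA mulrBr mulr1 mulrCA mulfV ?gt_eqF // mulr1.
have h3 : alpha * (T k - u) <= slope k * (T k - u).
  by rewrite ler_wpM2r ?subr_ge0 // ltW.
lra.
Qed.

Lemma piece_nd k u v : u <= v -> piece k u <= piece k v.
Proof.
move=> uv; have /andP[h1 _] := clamp_in k u; have /andP[_ h2] := clamp_in k v.
by apply: profile_nd => //; apply: clamp_nd.
Qed.

Lemma piece_lip k u v : u <= v ->
  piece k v - piece k u <= slope k * (clamp k v - clamp k u).
Proof.
move=> uv; have /andP[h1 _] := clamp_in k u; have /andP[_ h2] := clamp_in k v.
by apply: profile_lip => //; apply: clamp_nd.
Qed.

Lemma piece_eq0 k u : u <= S k -> piece k u = 0.
Proof.
move=> /clamp_le_start uS; rewrite /piece uS /profile subrr mulr0 add0r.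
by rewrite max_l ?mulr0 // subr_le0 window_start_le_end.
Qed.

Lemma exponentE N u : u <= N%:R -> exponent u = \sum_(k < N) piece k u.
Proof.
have extend M n : u <= M%:R ->
    \sum_(k < n + M) piece k u = \sum_(k < M) piece k u.
  move=> uM; elim: n => [//|n IH]; rewrite addSn big_ord_recr /= IH.
  rewrite piece_eq0 ?addr0 //; apply: le_trans uM _.
  apply: le_trans (window_start_ge (n + M)%N).
  by rewrite ler_nat ltnW // ltnS leq_addl.
move=> uN; rewrite /exponent.
rewrite -(extend _ N (ltW (truncnS_gt u))) -(extend _ (Num.truncn u).+1 uN).
by rewrite addnC.
Qed.

Lemma exponent_increment u v : exists N,
  exponent v - exponent u = \sum_(k < N) (piece k v - piece k u).
Proof.
pose N := (maxn (Num.truncn u) (Num.truncn v)).+1; exists N.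
have uN : u <= N%:R.
  by apply: le_trans (ltW (truncnS_gt u)) _; rewrite ler_nat ltnS leq_maxl.
have vN : v <= N%:R.
  by apply: le_trans (ltW (truncnS_gt v)) _; rewrite ler_nat ltnS leq_maxr.
by rewrite (exponentE uN) (exponentE vN) sumrB.
Qed.

Lemma exponent_nd u v : u <= v -> exponent u <= exponent v.
Proof.
move=> uv; rewrite -subr_ge0; have [N ->] := exponent_increment u v.
by apply: sumr_ge0 => k _; rewrite subr_ge0 piece_nd.
Qed.

Lemma piece_le_exponent k u v : u <= v ->
  piece k v - piece k u <= exponent v - exponent u.
Proof.
move=> uv; pose N := (Num.truncn v + k).+1.
have vN : v <= N%:R.
  by apply: le_trans (ltW (truncnS_gt v)) _; rewrite ler_nat ltnS leq_addr.
have kN : (k < N)%N by rewrite ltnS leq_addl.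
rewrite (exponentE vN) (exponentE (le_trans uv vN)) -sumrB.
rewrite (bigD1 (Ordinal kN)) //= lerDl.
by apply: sumr_ge0 => i _; rewrite subr_ge0 piece_nd.
Qed.

Lemma exponent_eq0 u : u <= 0 -> exponent u = 0.
Proof.
move=> u0; rewrite /exponent big1 // => k _; rewrite piece_eq0 //.
exact: le_trans u0 (ltW (window_start_gt0 k)).
Qed.

(* The windows are disjoint, so the clamped lengths add up to at most the
   length of [u, v]. *)
Lemma sum_clamp_le N u v : u <= v ->
  \sum_(k < N) (clamp k v - clamp k u) <=
  Num.min v (S N) - Num.min u (S N).
Proof.
move=> uv; elim: N => [|N IH].
  by rewrite big_ord0 subr_ge0 le_min2.
rewrite big_ord_recr /=.
have split w : Num.min w (S N) + clamp N w = S N + Num.min w (B N).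
  have h0 := window_le_burst N; rewrite /clamp.
  by case: (leP (S N) w) => h1; case: (leP w (B N)) => h2;
     case: (leP (B N) (S N)) => h3; lra.
have step : Num.min v (B N) - Num.min u (B N) <=
    Num.min v (S N.+1) - Num.min u (S N.+1).
  have h5 := burst_end_le_next N.
  by case: (leP v (B N)) => h1; case: (leP u (B N)) => h2;
     case: (leP v (S N.+1)) => h3; case: (leP u (S N.+1)) => h4; lra.
by have := split u; have := split v; lra.
Qed.

(** Pieces that ended before [u] do not change on the interval, so only the remaining slopes matter;
    the clamped lengths sum to at most [v - u]. *)
Lemma exponent_lip c u v : 0 <= c -> u <= v ->
  (forall k, slope k <= c \/ B k <= u) ->
  exponent v - exponent u <= c * (v - u).
Proof.
move=> c0 uv hc; have [N ->] := exponent_increment u v.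
apply: (@le_trans _ _ (c * \sum_(k < N) (clamp k v - clamp k u))).
  rewrite mulr_sumr; apply: ler_sum => k _.
  apply: le_trans (piece_lip k uv) _.
  have [sc|Bu] := hc k; first by rewrite ler_wpM2r // subr_ge0 clamp_nd.
  by rewrite !clamp_ge_end ?subrr ?mulr0 // (le_trans Bu uv).
rewrite ler_wpM2l //; apply: le_trans (sum_clamp_le N uv) _.
by case: (leP v (S N)) => h1; case: (leP u (S N)) => h2; lra.
Qed.

Lemma exponent_lip_dim u v : u <= v ->
  exponent v - exponent u <= d%:R * (v - u).
Proof.
move=> uv; apply: exponent_lip => // k; left.
by have [] := slope_bounds k.
Qed.

Lemma burst_increment k :
  alpha * k.+1%:R <= exponent (B k) - exponent (T k) /\
  1 <= exponent (B k) - exponent (T k).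
Proof.
have TB := ltW (window_end_lt k); have ST := window_start_le_end k.
have [a1 a2 _ _] := slope_bounds k.
have E : slope k * k.+1%:R <= exponent (B k) - exponent (T k).
  apply: le_trans (piece_le_exponent k TB).
  rewrite /piece !clamp_id ?lexx ?TB ?ST ?(le_trans ST TB) //.
  rewrite profile_increment // !beta_eq0; last 2 first.
  - by rewrite ler_pdivlMr ?mul1r ?window_end_gt0.
  - by rewrite divff // gt_eqF // window_end_gt0.
  rewrite subrr mulr0 add0r subrr maxxx mulr0 subr0 /B addrAC subrr add0r.
  by rewrite max_r.
split; apply: le_trans E; first by rewrite ler_wpM2r.
have k0 : (0 : R) <= k.+1%:R by [].
by have := ler_wpM2r k0 a2; rewrite mulVf ?pnatr_eq0.
Qed.

Lemma exponent_burst_end k : k.+1%:R <= exponent (B k).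
Proof.
elim: k => [|k IH].
  have [_] := burst_increment 0; have := exponent_nd (ltW (window_end_gt0 0)).
  rewrite exponent_eq0 //; lra.
have [_] := burst_increment k.+1.
have := exponent_nd (le_trans (burst_end_le_next k) (window_start_le_end k.+1)).
rewrite -[k.+2%:R]natr1; lra.
Qed.

Lemma exponent_unbounded M : exists u, M <= exponent u.
Proof.
exists (B (Num.truncn M)).
exact: le_trans (ltW (truncnS_gt M)) (exponent_burst_end _).
Qed.

(** From window [K] on all slopes are at most [alpha + e]; everything earlier is absorbed into
    [M]. *)
Lemma exponent_dimension_upper e : 0 < e -> exists M, forall u v, u <= v ->
  exponent v - exponent u <= (alpha + e) * (v - u) + M.
Proof.
move=> e0; pose K := Num.truncn e^-1.
have Ke k : (K <= k)%N -> slope k <= alpha + e.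
  move=> Kk; have [_ _ _ /le_trans] := slope_bounds k; apply; rewrite lerD2l.
  rewrite -[leRHS]invrK lef_pV2 ?posrE ?invr_gt0 //.
  by apply: le_trans (ltW (truncnS_gt _)) _; rewrite ler_nat.
have ae : 0 <= alpha + e by rewrite addr_ge0 // ltW.
have lip u v : u <= v -> S K <= u ->
    exponent v - exponent u <= (alpha + e) * (v - u).
  move=> uv Su; apply: exponent_lip => // k.
  have [/Ke|kK] := leqP K k; first by left.
  by right; apply: le_trans Su; apply: burst_end_le_start.
have fge0 u : 0 <= exponent u.
  have [/exponent_eq0->//|/ltW u0] := leP u 0.
  by rewrite -(exponent_eq0 (lexx 0)) exponent_nd.
exists (exponent (S K)) => u v uv.
have := fge0 u; have := fge0 (S K).
have [Su|/ltW uS] := leP (S K) u; first by have := lip u v uv Su; lra.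
have [Sv|/ltW vS] := leP (S K) v.
  have := lip _ _ Sv (lexx _).
  have : (alpha + e) * (v - S K) <= (alpha + e) * (v - u).
    by rewrite ler_wpM2l //; lra.
  lra.
have := exponent_nd vS.
have : 0 <= (alpha + e) * (v - u) by rewrite mulr_ge0 // subr_ge0.
lra.
Qed.

(** A single burst suffices: its surplus over slope [a] is at least [(alpha - a) * k.+1%:R]. *)
Lemma exponent_dimension_lower a M : a < alpha -> exists u v,
  u <= v /\ a * (v - u) + M < exponent v - exponent u.
Proof.
move=> aalpha; pose k := Num.truncn (M / (alpha - a)).
exists (T k), (B k); split; first exact: ltW (window_end_lt k).
have [h _] := burst_increment k; apply: lt_le_trans h.
have := truncnS_gt (M / (alpha - a)); rewrite ltr_pdivrMr ?subr_gt0 // -/k.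
have -> : B k - T k = k.+1%:R by rewrite /B addrAC subrr add0r.
lra.
Qed.

(** Take [t / theta = T k], the end of a window, where the increment of the profile is exactly
    [T k * beta theta]. *)
Lemma exponent_spectrum_lower theta s a M : 0 < theta < 1 ->
  beta theta = s * (1 - theta) -> a < s ->
  exists2 t, 0 <= t &
    a * (t / theta - t) + M < exponent (t / theta) - exponent t.
Proof.
move=> /andP[th0 th1] bE as_lt.
pose c := (s - a) * (1 - theta).
have c0 : 0 < c by rewrite mulr_gt0 ?subr_gt0.
(* The first summand makes the surplus exceed [M]; the second ensures [S k <= theta * T k], so that
   [t] lies in the window. *)
pose k := (Num.truncn (M / c) + Num.truncn theta^-1)%N.
have k1 : M < c * k.+1%:R.
  rewrite mulrC -ltr_pdivrMr //; apply: lt_le_trans (truncnS_gt _) _.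
  by rewrite ler_nat ltnS leq_addr.
have k2 : 1 <= theta * k.+1%:R.
  rewrite mulrC -ler_pdivrMr // div1r; apply: le_trans (ltW (truncnS_gt _)) _.
  by rewrite ler_nat ltnS leq_addl.
have T0 := window_end_gt0 k; have S0 := window_start_gt0 k.
have TB := ltW (window_end_lt k); have ST := window_start_le_end k.
have ST' : S k <= theta * T k.
  by rewrite /T mulrA ler_peMl // ltW.
have tT : theta * T k <= T k by rewrite ler_piMl // ltW.
exists (theta * T k); first by rewrite mulr_ge0 // ltW.
rewrite (mulrC theta) mulfK ?gt_eqF // (mulrC _ theta).
apply: lt_le_trans (piece_le_exponent k tT).
rewrite /piece !clamp_id ?ST' ?ST ?TB ?(le_trans tT TB) //.
rewrite profile_increment // divff ?gt_eqF // mulfK ?gt_eqF //.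
rewrite (beta_eq0 (lexx 1)) subr0 bE !max_l ?subr_le0 // subrr addr0.
have kT : k.+1%:R <= T k by apply: le_trans ST; apply: window_start_ge.
have : c * k.+1%:R <= c * T k by rewrite ler_pM2l.
by move: k1; rewrite /c; lra.
Qed.

Lemma piece_increment_support k u v : piece k v != piece k u -> u <= v ->
  u < B k /\ S k < v.
Proof.
move=> ne uv; split; rewrite ltNge; apply: contra ne => h.
  by rewrite /piece !clamp_ge_end // (le_trans h).
by rewrite !piece_eq0 // (le_trans uv).
Qed.

(** Clamping moves both ends inwards, which brings their ratio closer to 1, and [beta] is
    nonincreasing. *)
Lemma piece_increment_le k u v : 0 < u -> u <= v -> u <= B k -> S k <= v ->
  piece k v - piece k u <= v * beta (u / v) + d%:R * k.+1%:R.
Proof.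
move=> u0 uv uB Sv; have v0 : 0 < v by apply: lt_le_trans uv.
have /andP[h1 h2] := clamp_in k u; have /andP[h3 h4] := clamp_in k v.
have h5 := clamp_nd k uv.
apply: le_trans (profile_le_beta h1 h5 h4) _; rewrite lerD2r.
have ucl : u <= clamp k u by rewrite /clamp le_min uB le_max lexx orbT.
have clv : clamp k v <= v by rewrite /clamp ge_min ge_max lexx Sv !orbT.
have c0 : 0 < clamp k v by apply: lt_le_trans h3; apply: window_start_gt0.
have cu0 : 0 < clamp k u by apply: lt_le_trans h1; apply: window_start_gt0.
have ratio_le : u / v <= clamp k u / clamp k v.
  by rewrite ler_pM ?(ltW u0) ?invr_ge0 ?(ltW v0) // lef_pV2.
have r0 : 0 < u / v by rewrite divr_gt0.
have /andP[] := beta_subadd r0 ratio_le; rewrite subr_ge0 => hb _.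
have b0 : 0 <= beta (u / v) by apply: beta_ge0.
by apply: le_trans (_ : clamp k v * beta (u / v) <= _);
  [rewrite ler_pM2l|rewrite ler_wpM2r].
Qed.

(** For late [t] at most one piece changes between [t] and [t / theta]. It contributes
    [v * beta theta] plus a burst term at most [d%:R * k.+1%:R], which [e] absorbs since
    [k.+1%:R ^+ 2 <= S k < v]. Early [t] are absorbed into [M]. *)
Lemma exponent_spectrum_upper theta s e : 0 < theta < 1 ->
  beta theta = s * (1 - theta) -> 0 < e ->
  exists M, forall t, 0 <= t ->
    exponent (t / theta) - exponent t <= (s + e) * (t / theta - t) + M.
Proof.
move=> /andP[th0 th1] bE e0.
pose c := e * (1 - theta).
have c0 : 0 < c by rewrite mulr_gt0 ?subr_gt0.
have th1' : 0 < 1 - theta by rewrite subr_gt0.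
have s0 : 0 <= s.
  by rewrite -(pmulr_lge0 _ th1') -bE beta_ge0.
pose K := (Num.truncn (d%:R / c) + Num.truncn theta^-1)%N.
have K1 k : (K <= k)%N -> d%:R <= c * k.+1%:R.
  move=> Kk; rewrite mulrC -ler_pdivrMr //.
  apply: le_trans (ltW (truncnS_gt _)) _.
  by rewrite ler_nat ltnS (leq_trans _ Kk) // leq_addr.
have K2 k : (K <= k)%N -> 1 <= theta * k.+1%:R.
  move=> Kk; rewrite mulrC -ler_pdivrMr // div1r.
  apply: le_trans (ltW (truncnS_gt _)) _.
  by rewrite ler_nat ltnS (leq_trans _ Kk) // leq_addl.
have fge0 u : 0 <= exponent u.
  have [/exponent_eq0->//|/ltW u0] := leP u 0.
  by rewrite -(exponent_eq0 (lexx 0)) exponent_nd.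
exists (exponent (B K / theta)) => t t0.
set v := t / theta.
have tE : t = theta * v by rewrite mulrC divfK ?gt_eqF.
have v0 : 0 <= v by rewrite divr_ge0 // ltW.
have tv : t <= v by rewrite tE ler_piMl // ltW.
have rhs0 : 0 <= (s + e) * (v - t).
  by rewrite mulr_ge0 ?subr_ge0 // addr_ge0 // ltW.
have [tB|Bt] := leP t (B K).
  have : exponent v <= exponent (B K / theta).
    by apply: exponent_nd; rewrite ler_pM2r ?invr_gt0.
  by have := fge0 t; lra.
rewrite -[leLHS]addr0 lerD ?fge0 //.
have tpos : 0 < t by apply: lt_trans Bt; apply: burst_end_gt0.
have vpos : 0 < v by apply: lt_le_trans tv.
have active k : piece k v != piece k t -> (K < k)%N.
  move=> /piece_increment_support/(_ tv)[tBk _]; rewrite ltnNge.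
  by apply/negP => /burst_end_homo; lra.
(* Two changing pieces would give [v > S l >= k.+2%:R * B k > k.+2%:R * t], while
   [1 <= theta * k.+2%:R] gives [v <= k.+2%:R * t]. *)
have unique k l : (k < l)%N -> piece k v != piece k t -> piece l v = piece l t.
  move=> kl nek; apply/eqP; apply: contraT => nel.
  have Kk := active _ nek.
  have [tBk _] := piece_increment_support nek tv.
  have [_ Slv] := piece_increment_support nel tv.
  have := window_start_homo kl; have := burst_end_next k.
  have : k.+2%:R * t < k.+2%:R * B k by rewrite ltr_pM2l.
  have := K2 k.+1 (leqW (ltnW Kk)).
  have : v * 1 <= v * (theta * k.+2%:R) -> v <= k.+2%:R * t by rewrite tE; lra.
  rewrite ler_pM2l // => h1 /h1; lra.
have [N ->] := exponent_increment t v.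
have [[k nek]|none] := pselect (exists k : 'I_N, piece k v != piece k t).
  rewrite (bigD1 k) //= big1 ?addr0; last first.
    move=> l lk; apply/eqP; rewrite subr_eq0; apply/eqP.
    have [kl|] := ltnP k l; first exact: unique nek.
    rewrite leq_eqVlt (inj_eq val_inj) (negbTE lk) /= => lltk.
    apply/eqP; apply: contraT => nel.
    by have /eqP := unique _ _ lltk nel; rewrite (negbTE nek).
  have Kk := active _ nek.
  have [tBk Skv] := piece_increment_support nek tv.
  apply: le_trans (piece_increment_le tpos tv (ltW tBk) (ltW Skv)) _.
  have -> : t / v = theta by rewrite tE mulfK ?gt_eqF.
  have sq := window_start_sqr k; rewrite bE.
  have k0 : 0 <= k.+1%:R :> R by [].
  have := ler_wpM2r k0 (K1 _ (ltnW Kk)).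
  have : c * k.+1%:R ^+ 2 <= c * v.
    by rewrite ler_pM2l // (le_trans sq) // ltW.
  rewrite tE /c; lra.
rewrite big1 // => k _; apply/eqP; rewrite subr_eq0.
by apply: contraT => ne; case: none; exists k.
Qed.

End Profile.

Theorem theorem3p6 (R : realType) (d : nat) (phi : R -> R) (alpha : R)
    (hd : (0 < d)%N) (hphi : classA d phi)
    (halpha1 : value_at1 phi <= alpha) (halphad : alpha <= d%:R) :
  exists C : set 'rV[R]_d,
    [/\ homogeneous_moran_set C,
        assouad_dimension C = alpha%:E
      & forall theta : R, 0 < theta < 1 ->
          assouad_spectrum theta C = (phi theta)%:E].
Proof.
have phi_le x : 0 < x < 1 -> phi x <= alpha.
  by move=> /(classA_le_value_at1 hphi)/le_trans; apply.
have alpha0 : 0 <= alpha.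
  have half01 : 0 < (2^-1 : R) < 1 by apply/andP; split; lra.
  exact: le_trans (classA_ge0 hphi half01) (phi_le _ half01).
have defectE x : 0 < x < 1 -> defect phi x = phi x * (1 - x).
  by case/andP=> _; rewrite /defect mulrC => ->.
(* Here [value_at1 phi <= alpha] enters, through [phi_le]: it keeps the windows from exceeding slope
   [alpha]. *)
have defect_le x : 0 < x < 1 -> defect phi x <= alpha * (1 - x).
  move=> x01; rewrite defectE // ler_wpM2r ?phi_le //.
  by case/andP: x01 => _ /ltW; rewrite subr_ge0.
have b0 := defect_ge0 hphi; have b1 := defect_eq0 phi.
have bsub := defect_subadd hphi.
pose f := exponent (defect phi) alpha.
have f_nd : forall t T, t <= T -> f t <= f T.
  by move=> t T; apply: (exponent_nd hd).
have f_eq0 : forall t, t <= 0 -> f t = 0 by move=> t; apply: exponent_eq0.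
have f_lip : forall t T, t <= T -> f T - f t <= d%:R * (T - t).
  by move=> t T; apply: (exponent_lip_dim hd).
have f_unb : forall M, exists t, M <= f t.
  exact: (exponent_unbounded hd).
have [r [hr [tau sideE f_tau]]] := exists_ratios hd f_nd f_eq0 f_lip f_unb.
exists (moran_set r); split; first by exists r.
  apply: (dimension_moran_set hd f_nd f_eq0 hr sideE f_tau alpha0).
    exact: (exponent_dimension_upper hd).
  exact: (exponent_dimension_lower hd).
move=> theta th01.
apply: (spectrum_moran_set hd f_nd f_eq0 hr sideE f_tau th01).
  by move=> e; apply: (exponent_spectrum_upper hd) => //; apply: defectE.
move=> a M; apply: (exponent_spectrum_lower hd) => //; exact: defectE.
Qed.
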